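(* For every $y_0\in Y$ and every $\epsilon\in(0,1)$, $k^*(\epsilon,y_0)=\mu^*(\epsilon,y_0)$; moreover, $k^*=\mu^*$.
   Context: Model. $Y\subset\mathbb R^n$ is a nonempty compact set, $\hat U$ is a compact metric space, $S$ is a Polish space. The function $f:Y\times\hat U\times S\to\mathbb R^n$ is bounded, continuous in $(y,u)$ on $Y\times\hat U$ and Borel measurable in $s$ on $S$. $s$ is a random element of $S$ with a given distribution, and $E[\varphi(f(y,u,s))]$ is the expectation over $s$ with $(y,u)$ fixed. $U(\cdot)$ is an upper semicontinuous multivalued map from $Y$ to nonempty compact subsets of $\hat U$, and $f(y,u,s)\in Y$ for all $y\in Y$, $u\in U(y)$, $s\in S$. $G:=\{(y,u): y\in Y,\ u\in U(y)\}$ (a compact set). The function $k:Y\times\hat U\to\mathbb R$ is continuous (hence bounded). $\mathcal P(G)$ is the set of probability measures on Borel subsets of $G$; $C(Y)$ is the space of continuous functions on $Y$. Define $$W(\epsilon,y_0):=\Big\{\gamma\in\mathcal P(G):\int_G\big((1-\epsilon)(E[\varphi(f(y,u,s))]-\varphi(y))+\epsilon(\varphi(y_0)-\varphi(y))\big)\gamma(dy,du)=0\ \forall\varphi\in C(Y)\Big\},$$ $$W:=\Big\{\gamma\in\mathcal P(G):\int_G\big(E[\varphi(f(y,u,s))]-\varphi(y)\big)\gamma(dy,du)=0\ \forall\varphi\in C(Y)\Big\},$$ $$k^*(\epsilon,y_0):=\min_{\gamma\in W(\epsilon,y_0)}\int_Gk(y,u)\gamma(dy,du),\qquad k^*:=\min_{\gamma\in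 W}\int_Gk(y,u)\gamma(dy,du),$$ $$\mu^*(\epsilon,y_0):=\sup_{\psi\in C(Y)}\min_{(y,u)\in G}\big\{k(y,u)+(1-\epsilon)(E[\psi(f(y,u,s))]-\psi(y))+\epsilon(\psi(y_0)-\psi(y))\big\},$$ $$\mu^*:=\sup_{\psi\in C(Y)}\min_{(y,u)\in G}\big\{k(y,u)+E[\psi(f(y,u,s))]-\psi(y)\big\}.$$ *)

(* Defs.v *)
From HB Require Import structures.
From mathcomp Require Import all_boot all_order all_algebra.
From mathcomp Require Import all_classical all_reals all_analysis.

Set Implicit Arguments.
Unset Strict Implicit.
Unset Printing Implicit Defensive.

Import Order.TTheory GRing.Theory Num.Theory.
Import numFieldNormedType.Exports.

Local Open Scope classical_set_scope.
Local Open Scope ring_scope.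

(* MathComp-Analysis equips only pointed types with a sigma-algebra; the
   distinguished point plays no other role. *)
#[short(type="pmetricType")]
HB.structure Definition PointedMetric (K : numDomainType) :=
  { M of Metric K M & Pointed M }.

Notation borel T := (g_sigma_algebraType (@open T%type)).

(* Separable and completely metrizable: the metric [d] is not part of the
   structure, only the topology is. *)
Definition polish (R : realType) (T : topologicalType) : Prop :=
  (exists2 D : set T, countable D & dense D) /\
  exists d : T -> T -> R,
    [/\ forall x y, 0 <= d x y /\ (d x y = 0 <-> x = y),
        forall x y, d x y = d y x,
        forall x y z, d x z <= d x y + d y z,
        forall x (A : set T),
          nbhs x A <-> exists2 e : R, 0 < e & [set y | d x y < e] `<=` A
      & forall u : nat -> T,
          (forall e : R, 0 < e ->
             exists N, forall i j, (N <= i)%N -> (N <= j)%N -> d (u i) (u j) < e) ->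
          exists l : T, u @ \oo --> l].

Definition upper_semicontinuous_on (T X : topologicalType) (Y : set T)
    (F : T -> set X) : Prop :=
  forall y, Y y -> forall V : set X, open V -> F y `<=` V ->
    \forall z \near within Y (nbhs y), F z `<=` V.

(* C(Y): functions are total, but only their values on [Y] are ever used below
   (for [phi \o f], because [f] maps G x S into [Y]). *)
Definition CY (T : topologicalType) (R : realType) (Y : set T) : set (T -> R) :=
  [set phi | {within Y, continuous phi}].

Definition attains_min (R : realType) (A : set (\bar R)) : Prop :=
  A (ereal_inf A).

Section ControlModel.
Variables (R : realType) (n : nat) (U : pmetricType R) (S : ptopologicalType).
Variable law : probability (borel S) R.
Variables (Y : set 'rV[R]_n) (Uad : 'rV[R]_n -> set U).
Variable f : 'rV[R]_n -> U -> S -> 'rV[R]_n.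
Variable k : 'rV[R]_n -> U -> R.

Definition graph : set ('rV[R]_n * U) := [set p | Y p.1 /\ Uad p.1 p.2].

Definition expect (phi : 'rV[R]_n -> R) (y : 'rV[R]_n) (u : U) : R :=
  \int[law]_s phi (f y u s).

(* P(G): G is a closed subset of R^n x U, so a probability measure on the Borel
   subsets of G is a Borel probability measure on R^n x U that gives G mass 1. *)
Definition PG : set (probability (borel ('rV[R]_n * U)) R) :=
  [set gamma | gamma graph = 1%E].

Definition Wdisc (eps : R) (y0 : 'rV[R]_n) :
    set (probability (borel ('rV[R]_n * U)) R) :=
  [set gamma | PG gamma /\ forall phi, CY Y phi ->
    \int[gamma]_(p in graph)
      ((1 - eps) * (expect phi p.1 p.2 - phi p.1) + eps * (phi y0 - phi p.1))
    = 0].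

Definition W : set (probability (borel ('rV[R]_n * U)) R) :=
  [set gamma | PG gamma /\ forall phi, CY Y phi ->
    \int[gamma]_(p in graph) (expect phi p.1 p.2 - phi p.1) = 0].

Definition costs (V : set (probability (borel ('rV[R]_n * U)) R)) :
    set (\bar R) :=
  [set (\int[gamma]_(p in graph) k p.1 p.2)%:E | gamma in V].

Definition dual_values_disc (eps : R) (y0 : 'rV[R]_n) (psi : 'rV[R]_n -> R) :
    set (\bar R) :=
  [set (k p.1 p.2 + (1 - eps) * (expect psi p.1 p.2 - psi p.1)
        + eps * (psi y0 - psi p.1))%:E | p in graph].

Definition dual_values (psi : 'rV[R]_n -> R) : set (\bar R) :=
  [set (k p.1 p.2 + expect psi p.1 p.2 - psi p.1)%:E | p in graph].

(* Minima are written as infima in the extended reals, so that no junk value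
   arises; that they are attained is stated separately with [attains_min]. *)
Definition kstar_disc (eps : R) (y0 : 'rV[R]_n) : \bar R :=
  ereal_inf (costs (Wdisc eps y0)).

Definition kstar : \bar R := ereal_inf (costs W).

Definition mustar_disc (eps : R) (y0 : 'rV[R]_n) : \bar R :=
  ereal_sup [set ereal_inf (dual_values_disc eps y0 psi) | psi in CY Y].

Definition mustar : \bar R :=
  ereal_sup [set ereal_inf (dual_values psi) | psi in CY Y].

End ControlModel.

(* Main.v *)
Require Import Defs.
From HB Require Import structures.
From mathcomp Require Import all_boot all_order all_algebra.
From mathcomp Require Import all_classical all_reals all_analysis.
From mathcomp Require Import finmap measurable_realfun ring lra.

(* The undiscounted problem is the case eps = 0 of the discounted one. Let
   T psi (y, u) = (1 - eps) (E psi(f(y, u, s)) - psi(y)) + eps (psi(y0) - psi(y)).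
   On the bounded functions on the compact graph G, the functional
   p(h) = inf_psi sup_G (h + T psi) is sublinear; it is finite because T psi >= 0
   above a minimizer of psi. By Hahn-Banach there is a linear L <= p with
   L(-k) = p(-k). It is positive, normalized and vanishes on every T psi, so the
   probability measure representing it on continuous functions is feasible, and
   its cost L(k) = - p(-k) is the dual value. As L is defined on indicators too,
   the measure is built by regularizing the finitely additive set function
   A |-> L(1_A). *)

Set Implicit Arguments.
Unset Strict Implicit.
Unset Printing Implicit Defensive.

Import Order.TTheory GRing.Theory Num.Theory.
Import numFieldNormedType.Exports.

Local Open Scope classical_set_scope.
Local Open Scope ring_scope.

(** * Hahn-Banach theorem *)

Lemma inf_lbound_le (R : realType) (A : set R) (m x : R) :
  (forall y, A y -> m <= y) -> A x -> inf A <= x.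
Proof. by move=> mA Ax; apply: ge_inf => //; exists m. Qed.

Section HahnBanach.
Variables (R : realType) (V : lmodType R) (B : set V).
Hypothesis BD : forall u v, B u -> B v -> B (u + v).
Hypothesis BZ : forall c v, B v -> B (c *: v).

Definition sublinear_on (q : V -> R) : Prop :=
  (forall u v, B u -> B v -> q (u + v) <= q u + q v) /\
  (forall c v, 0 < c -> B v -> q (c *: v) <= c * q v).

Let BN v : B v -> B (- v). Proof. by move=> Bv; rewrite -scaleN1r; exact: BZ. Qed.

Lemma sublinear_homogeneous q c v :
  sublinear_on q -> 0 <= c -> B v -> q (c *: v) = c * q v.
Proof.
(* The factors 2 and 1/2 at the origin give [q 0 <= 2 * q 0] and [q 0 <= q 0 / 2], hence
   [q 0 = 0]. *)
move=> [_ qZ] c0 Bv; have q0 : q 0 = 0.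
  have B0 : B 0 by rewrite -(scale0r v); exact: BZ.
  have := qZ 2 0 _ B0; have := qZ (2^-1) 0 _ B0.
  rewrite !scaler0 invr_gt0 ltr0n => /(_ isT) h1 /(_ isT); lra.
move: c0; rewrite le_eqVlt => /predU1P[<-|c0]; first by rewrite scale0r mul0r.
apply/eqP; rewrite eq_le qZ//=.
(* The reverse inequality is the assumed one for [c^-1] and [c *: v]. *)
have := qZ c^-1 (c *: v) _ (BZ c Bv).
rewrite scalerA mulVf ?gt_eqF// scale1r invr_gt0 => /(_ c0).
by rewrite ler_pdivlMl.
Qed.

Lemma sublinear_ge_opp q v : sublinear_on q -> B v -> - q (- v) <= q v.
Proof.
move=> qs Bv; have := sublinear_homogeneous qs (lexx 0) Bv.
have := qs.1 v (- v) Bv (BN Bv).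
by rewrite scale0r subrr mul0r; lra.
Qed.

(* Sublinear and below [q], with the least value at [- v] that sublinearity
   allows, namely [- q v]. *)
Definition tilt (q : V -> R) (v x : V) : R :=
  inf [set q (x + t *: v) - t * q v | t in [set t | 0 <= t]].

Section Tilt.
Variables (q : V -> R) (v : V).
Hypotheses (qs : sublinear_on q) (Bv : B v).

(** From [t * q v = q (t *: v) <= q (x + t *: v) + q (- x)]. The bound does not depend on [t], so
    the infimum in [tilt] is finite. *)
Let tilt_lb x t : B x -> 0 <= t -> - q (- x) <= q (x + t *: v) - t * q v.
Proof.
move=> Bx t0; rewrite -(sublinear_homogeneous qs t0 Bv).
have := qs.1 (x + t *: v) (- x) (BD Bx (BZ t Bv)) (BN Bx).
by rewrite addrC addKr; lra.
Qed.

Lemma tilt_le x t : B x -> 0 <= t -> tilt q v x <= q (x + t *: v) - t * q v.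
Proof.
move=> Bx t0; apply: (@inf_lbound_le _ _ (- q (- x))); last by exists t.
by move=> _ [s s0 <-]; exact: tilt_lb.
Qed.

Let le_tilt x m : (forall t, 0 <= t -> m <= q (x + t *: v) - t * q v) ->
  m <= tilt q v x.
Proof.
move=> mq; apply: lb_le_inf; first by exists (q (x + 0 *: v) - 0 * q v); exists 0 => /=.
by move=> _ [t t0 <-]; exact: mq.
Qed.

Lemma tilt_le_id x : B x -> tilt q v x <= q x.
Proof. by move=> Bx; have := tilt_le Bx (lexx 0); rewrite scale0r addr0 mul0r subr0. Qed.

Lemma tilt_opp : tilt q v (- v) <= - q v.
Proof.
have := tilt_le (BN Bv) ler01; rewrite scale1r addNr mul1r.
by have := sublinear_homogeneous qs (lexx 0) Bv; rewrite scale0r mul0r => ->; rewrite sub0r.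
Qed.

(** Near-optimal parameters [s] for [x] and [t] for [y] combine to [s + t] for [x + y]; scaling [x]
    by [c] scales the parameter to [c * t]. *)
Lemma tilt_sublinear : sublinear_on (tilt q v).
Proof.
split=> [x y Bx By|c x c0 Bx].
  rewrite -lerBlDr; apply: le_tilt => s s0; rewrite lerBlDr -lerBlDl.
  apply: le_tilt => t t0; rewrite lerBlDl.
  apply: (le_trans (tilt_le (BD Bx By) (addr_ge0 s0 t0))).
  have := qs.1 (x + s *: v) (y + t *: v) (BD Bx (BZ s Bv)) (BD By (BZ t Bv)).
  rewrite addrACA -scalerDl; lra.
rewrite -ler_pdivrMl//; apply: le_tilt => t t0; rewrite ler_pdivrMl//.
apply: (le_trans (tilt_le (BZ c Bx) (mulr_ge0 (ltW c0) t0))).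
rewrite -scalerA -scalerDr mulrBr mulrA lerB//.
by apply: qs.2 => //; apply: BD => //; exact: BZ.
Qed.

End Tilt.

Variable p : V -> R.
Hypothesis ps : sublinear_on p.

Let below := {q : V -> R | sublinear_on q /\ forall v, B v -> q v <= p v}.

(** The order is reversed, so that the maximal elements of Zorn's lemma are the minimal sublinear
    functionals below [p]. *)
Let below_rel (s t : below) : bool := `[< forall v, B v -> sval t v <= sval s v >].

Let below_lb (s : below) v : B v -> - p (- v) <= sval s v.
Proof.
case: s => /= q [qs qp] Bv; rewrite (le_trans _ (sublinear_ge_opp qs Bv))//.
by rewrite lerN2; exact/qp/BN.
Qed.

(** The bound of a nonempty chain is its pointwise infimum, finite by [below_lb]; the empty chain is
    bounded by [p]. *)
Let below_chain (A : set below) : total_on A below_rel ->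
  exists t, forall s, A s -> below_rel s t.
Proof.
move=> Atot; have [[s0 As0]|A0] := pselect (A !=set0); last first.
  exists (exist _ p (conj ps (fun v _ => lexx _))) => s As.
  by case: A0; exists s.
pose r v := inf [set sval s v | s in A].
have r_le v s : B v -> A s -> r v <= sval s v.
  move=> Bv As; apply: (@inf_lbound_le _ _ (- p (- v))); last by exists s.
  by move=> _ [t At <-]; exact: below_lb.
have le_r v m : (forall s, A s -> m <= sval s v) -> m <= r v.
  move=> mA; apply: lb_le_inf; first by exists (sval s0 v); exists s0.
  by move=> _ [t At <-]; exact: mA.
have rs : sublinear_on r.
  split=> [u v Bu Bv|c v c0 Bv].
    rewrite -lerBlDr; apply/le_r => s As; rewrite lerBlDr -lerBlDl.
    apply/le_r => t At; rewrite lerBlDl.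
    (* The smaller of [s] and [t] is used for both [u] and [v]; its own subadditivity then gives the
       bound. *)
    have [/asboolP st|/asboolP ts] := Atot _ _ As At.
      apply: (le_trans (r_le _ _ (BD Bu Bv) At)).
      apply: (le_trans ((svalP t).1.1 _ _ Bu Bv)); rewrite lerD2r; exact: st.
    apply: (le_trans (r_le _ _ (BD Bu Bv) As)).
    apply: (le_trans ((svalP s).1.1 _ _ Bu Bv)); rewrite lerD2l; exact: ts.
  rewrite -ler_pdivrMl//; apply/le_r => s As; rewrite ler_pdivrMl//.
  by rewrite (le_trans (r_le _ _ (BZ c Bv) As))//; exact: (svalP s).1.2.
have rp v : B v -> r v <= p v.
  by move=> Bv; rewrite (le_trans (r_le _ _ Bv As0))//; exact: (svalP s0).2.
exists (exist _ r (conj rs rp)) => s As; apply/asboolP => v Bv /=; exact: r_le.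
Qed.

(* A minimal sublinear functional equals all its tilts, hence is linear. *)
Lemma hahn_banach : exists L : V -> R,
  [/\ forall v, B v -> L v <= p v,
      forall u v, B u -> B v -> L (u + v) = L u + L v
    & forall c v, B v -> L (c *: v) = c * L v].
Proof.
have [|r s t /asboolP rs /asboolP st||[q [qs qp]] qmin] :=
    @ZL_preorder below (exist _ p (conj ps (fun v _ => lexx _))) below_rel.
- by move=> t; apply/asboolP.
- by apply/asboolP => v Bv; rewrite (le_trans (st _ Bv))// rs.
- exact: below_chain.
(* [tilt q v] lies below [q], so minimality forces the converse inequality; its parameter [t = 1]
   then yields superadditivity of [q]. *)
have qtilt u v : B u -> B v -> q u <= tilt q v u.
  move=> Bu Bv; have tp w : B w -> tilt q v w <= p w.
    by move=> Bw; rewrite (le_trans (tilt_le_id qs Bv Bw))// qp.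
  suff /qmin/asboolP : below_rel (exist _ q (conj qs qp))
      (exist _ _ (conj (tilt_sublinear qs Bv) tp)) by exact.
  by apply/asboolP => w Bw /=; exact: tilt_le_id.
have qD u v : B u -> B v -> q (u + v) = q u + q v.
  move=> Bu Bv; apply/eqP; rewrite eq_le qs.1//=.
  have := le_trans (qtilt _ _ Bu Bv) (tilt_le qs Bv Bu ler01).
  by rewrite scale1r mul1r; lra.
have qN v : B v -> q (- v) = - q v.
  move=> Bv; have := qD _ _ Bv (BN Bv); rewrite subrr -(scale0r v).
  by rewrite (sublinear_homogeneous qs (lexx 0) Bv); lra.
exists q; split=> // c v Bv; have [c0|c0] := leP 0 c.
  exact: sublinear_homogeneous.
rewrite -[c]opprK scaleNr qN; last exact: BZ.
by rewrite (sublinear_homogeneous qs _ Bv) ?mulNr// oppr_ge0 ltW.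
Qed.

End HahnBanach.

(** Hahn-Banach is applied to the tilt of [p] at [w]: then [L (- w) <= tilt p w (- w) <= - p w],
    which is tightness at [w]. *)
Lemma hahn_banach_tight (R : realType) (V : lmodType R) (B : set V) (p : V -> R)
    (w : V) :
  (forall u v, B u -> B v -> B (u + v)) -> (forall c v, B v -> B (c *: v)) ->
  sublinear_on B p -> B w ->
  exists L : V -> R,
  [/\ forall v, B v -> L v <= p v, p w <= L w,
      forall u v, B u -> B v -> L (u + v) = L u + L v
    & forall c v, B v -> L (c *: v) = c * L v].
Proof.
move=> BD BZ ps Bw.
have [L [Lt LD LZ]] := hahn_banach BD BZ (tilt_sublinear BD BZ ps Bw).
exists L; split=> // [v Bv|].
  exact: (le_trans (Lt _ Bv) (tilt_le_id BD BZ ps Bw Bv)).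
have BNw : B (- w) by rewrite -scaleN1r; exact: BZ.
have := le_trans (Lt _ BNw) (tilt_opp BD BZ ps Bw).
by rewrite -scaleN1r LZ// mulN1r lerN2.
Qed.

(** * Borel measure dominating a finitely additive one on compact sets *)

(** By regularity each point of [K] has an open neighbourhood whose closure lies in a single [O i];
    finitely many of them cover [K]. *)
Lemma compact_split (X : ptopologicalType) (K : set X) (O : nat -> set X) :
  hausdorff_space X -> regular_space X -> compact K -> (forall i, open (O i)) ->
  K `<=` \bigcup_i O i ->
  exists N (C : nat -> set X),
    [/\ forall i, compact (C i), forall i, C i `<=` O i
      & K `<=` \bigcup_(i < N) C i].
Proof.
move=> hX rX cK oO KO.
have loc (x : X) : exists iB : nat * set X, K x ->
    [/\ open iB.2, iB.2 x & closure iB.2 `<=` O iB.1].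
  have [Kx|nKx] := pselect (K x); last by exists (0%N, set0).
  have [i _ Oix] := KO _ Kx.
  have [B Bx BO] := rX x _ (open_nbhs_nbhs (conj (oO i) Oix)).
  exists (i, B°) => _; split => /=; first exact: open_interior.
    exact: nbhs_singleton (nbhs_interior Bx).
  exact: subset_trans (closureS (@interior_subset _ _)) BO.
have [g gP] := choice loc.
have /(_ X K (fun x => (g x).2)) [x /gP[]//||] : cover_compact K.
  by rewrite -compact_cover.
- by move=> x Kx; exists x => //; have [] := gP _ Kx.
move=> D DK KD.
(* [C i] gathers the closures of the selected neighbourhoods assigned to index [i]. *)
pose C i := K `&` \bigcup_(x in [set x | x \in D /\ (g x).1 = i]) closure (g x).2.
exists (\max_(x <- D) (g x).1).+1, C; split=> [i|i x [_ [y [yD <-]]]|x Kx].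
- rewrite /C; apply: compact_closedI => //; apply: closed_bigcup => [|x _].
    by apply: sub_finite_set (finite_fset D) => x [].
  exact: closed_closure.
- by have [_ _] := gP _ (set_mem (DK _ yD)); exact.
- have [y yD gyx] := KD _ Kx.
  exists (g y).1; first by rewrite /= ltnS; exact: leq_bigmax_seq.
  by split=> //; exists y => //; exact: subset_closure.
Qed.

Section RegularOuterMeasure.
Variables (R : realType) (X : ptopologicalType) (nu : set X -> R).
Hypotheses (hX : hausdorff_space X) (rX : regular_space X).
Hypothesis nu_ge0 : forall A, 0 <= nu A.
Hypothesis nuU : forall A B, A `&` B = set0 -> nu (A `|` B) = nu A + nu B.

Let nu0 : nu set0 = 0.
Proof. by have := nuU (setI0 set0); rewrite setU0; lra. Qed.

Let nu_le A B : A `<=` B -> nu A <= nu B.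
Proof. by move=> AB; rewrite -(setDUK AB) nuU ?lerDl// setDIK. Qed.

Let nuU_le A B : nu (A `|` B) <= nu A + nu B.
Proof.
rewrite -(setDUK (@subsetUl _ A B)) nuU ?setDIK// lerD2l.
by apply: nu_le => x [[|//]].
Qed.

Let nu_bigU_le (C : nat -> set X) N :
  nu (\bigcup_(i < N) C i) <= \sum_(i < N) nu (C i).
Proof.
rewrite bigcup_mkord; elim: N => [|N IH]; first by rewrite !big_ord0 nu0.
by rewrite !big_ord_recr /= (le_trans (nuU_le _ _))// lerD2r.
Qed.

Local Open Scope ereal_scope.

(** Testing only compact subsets lets finite additivity of [nu] give countable subadditivity: a
    compact subset of a countable union of open sets meets the problem in finitely many pieces. *)
Let lam (O : set X) : \bar R :=
  ereal_sup [set (nu K)%:E | K in [set K | compact K /\ K `<=` O]].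

(** The outer measure that the classical theory of contents attaches to [nu]: inner approximation on
    open sets, then outer approximation by them. *)
Definition regular_ext (A : set X) : \bar R :=
  ereal_inf [set lam O | O in [set O | open O /\ A `<=` O]].

Let lam_ge K O : compact K -> K `<=` O -> (nu K)%:E <= lam O.
Proof. by move=> cK KO; apply: ereal_sup_ubound; exists K. Qed.

Let lam_le O (x : \bar R) :
  (forall K, compact K -> K `<=` O -> (nu K)%:E <= x) -> lam O <= x.
Proof. by move=> h; apply: ub_ereal_sup => _ [K [cK KO] <-]; exact: h. Qed.

Let lam_ge0 O : 0 <= lam O.
Proof.
have -> : 0 = (nu set0)%:E by rewrite nu0.
by apply: lam_ge (@sub0set _ _); exact: compact0.
Qed.

Let ext_le A O : open O -> A `<=` O -> regular_ext A <= lam O.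
Proof. by move=> oO AO; apply: ereal_inf_lbound; exists O. Qed.

Let le_ext A x : (forall O, open O -> A `<=` O -> x <= lam O) -> x <= regular_ext A.
Proof. by move=> h; apply/ereal_infP => _ [V [oV AV] <-]; exact: h. Qed.

Let ext_ge0 A : 0 <= regular_ext A.
Proof. by apply: le_ext => O _ _; exact: lam_ge0. Qed.

Let ext0 : regular_ext set0 = 0.
Proof.
apply/eqP; rewrite eq_le ext_ge0 andbT.
apply: (le_trans (ext_le open0 (@sub0set _ _))).
by apply: lam_le => K _; rewrite subset0 => ->; rewrite nu0.
Qed.

Let ext_homo : {homo regular_ext : A B / A `<=` B >-> A <= B}.
Proof. by move=> A B AB; apply: le_ext => O oO /(subset_trans AB); exact: ext_le. Qed.

Let ext_ltoo A : regular_ext A <= (nu setT)%:E.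
Proof.
apply: (le_trans (ext_le openT (@subsetT _ _))).
by apply: lam_le => K _ _; rewrite lee_fin nu_le.
Qed.

Let ext_sigma_subadditive : sigma_subadditive regular_ext.
Proof.
move=> F; apply/lee_addgt0Pr => e e0.
have Oex n : exists O, [/\ open O, F n `<=` O &
    lam O <= regular_ext (F n) + (e / (2 ^ n.+1)%:R)%:E].
  have e2 : (0 < e / (2 ^ n.+1)%:R)%R by rewrite divr_gt0// ltr0n expn_gt0.
  have fe : regular_ext (F n) \is a fin_num.
    by rewrite ge0_fin_numE// (le_lt_trans (ext_ltoo _))// ltry.
  have [_ [V [oV FV] <-] /ltW] := lb_ereal_inf_adherent e2 fe.
  by exists V.
have [Q QP] := choice Oex.
apply: le_trans (epsilon_trick xpredT (fun n => ext_ge0 (F n)) (ltW e0)).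
have oQ n : open (Q n) by have [] := QP n.
apply: (@le_trans _ _ (lam (\bigcup_n Q n))).
  apply: ext_le; first by apply: bigcup_open => n _; exact: oQ.
  by apply: subset_bigcup => n _; have [] := QP n.
apply: (@le_trans _ _ (\sum_(n <oo) lam (Q n))); last first.
  by apply: lee_nneseries => n _ //; have [] := QP n.
(* [compact_split] cuts [K] into compact pieces [C n] inside [Q n], which reduces the claim to
   finite subadditivity of [nu]. *)
apply: lam_le => K cK KO.
have [N [C [cC CO KC]]] := compact_split hX rX cK oQ KO.
apply: (@le_trans _ _ (\sum_(0 <= n < N) lam (Q n))).
  apply: (@le_trans _ _ (\sum_(n < N) nu (C n))%:E).
    by rewrite lee_fin (le_trans (nu_le KC))//; exact: nu_bigU_le.
  by rewrite -sumEFin big_mkord lee_sum// => i _; exact: lam_ge.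
by apply: nneseries_lim_ge => n _ _; exact: lam_ge0.
Qed.

HB.instance Definition _ := isOuterMeasure.Build R X regular_ext
  ext0 ext_ge0 ext_homo ext_sigma_subadditive.

Lemma regular_ext_ge K : compact K -> (nu K)%:E <= regular_ext K.
Proof. by move=> cK; apply: le_ext => O _; exact: lam_ge. Qed.

(** Let [K] be compact in [O] and [A], and [L] compact in [O] minus [K]. They are disjoint with
    compact union in [O], so [nu K + nu L <= lam O]. The supremum over [L], then over [K], splits
    [lam O] as required. *)
Let ext_caratheodory_open A : open A -> regular_ext.-caratheodory A.
Proof.
move=> oA; apply: le_caratheodory_measurable => E; apply: le_ext => O oO EO.
apply: (@le_trans _ _ (lam (O `&` A) + regular_ext (E `&` ~` A))).
  rewrite leeD2r// ext_le//; first exact: openI.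
  exact: setSI.
rewrite -leeBrDr ?ge0_fin_numE//; last by rewrite (le_lt_trans (ext_ltoo _))// ltry.
apply: lam_le => K cK; rewrite subsetI => -[KO KA].
have clK := compact_closed hX cK.
rewrite leeBrDr ?ge0_fin_numE//; last by rewrite (le_lt_trans (ext_ltoo _))// ltry.
rewrite -leeBrDl//.
apply: (@le_trans _ _ (lam (O `&` ~` K))).
  apply: ext_le; first by apply: openI => //; exact: closed_openC.
  by move=> x [Ex nAx]; split; [exact: EO|move=> /KA].
apply: lam_le => L cL; rewrite subsetI => -[LO LK].
rewrite leeBrDl// -EFinD -nuU; last first.
  by rewrite -subset0 => x [Kx /LK].
by apply: lam_ge; [exact: compactU|rewrite subUset].
Qed.

Let ext_caratheodory_borel (A : set (borel X)) :
  measurable A -> regular_ext.-caratheodory A.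
Proof.
apply: (@smallest_sub _ _ _ (regular_ext.-caratheodory : set (set X))).
  split; [exact: caratheodory_measurable_set0| |].
    by move=> B mB; rewrite setTD; exact: caratheodory_measurable_setC.
  exact: caratheodory_measurable_bigcup.
exact: ext_caratheodory_open.
Qed.

Definition regular_measure : set (borel X) -> \bar R := regular_ext.

Let regular_measure_sigma_additive : semi_sigma_additive regular_measure.
Proof.
move=> F mF tF mUF; apply: caratheodory_measure_sigma_additive => //.
  by move=> i; exact: ext_caratheodory_borel (mF i).
exact: ext_caratheodory_borel mUF.
Qed.

HB.instance Definition _ := isMeasure.Build _ (borel X) R regular_measure
  ext0 ext_ge0 regular_measure_sigma_additive.

Variable G : set X.
Hypotheses (cG : compact G) (nuT : nu setT = 1%R) (nuG : nu G = 1%R).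

Let regular_measureT : regular_measure setT = 1.
Proof.
apply/eqP; rewrite eq_le -{1}nuT ext_ltoo/= -nuG.
by rewrite (le_trans (regular_ext_ge cG))// ext_homo.
Qed.

HB.instance Definition _ := Measure_isProbability.Build _ _ _ regular_measure
  regular_measureT.

(** On compact sets [P] may exceed [nu]; the one-sided bound suffices because the Riesz argument
    applies it to both [h] and [- h]. *)
Lemma regular_probability : exists P : probability (borel X) R,
  P G = 1 /\ forall K, compact K -> (nu K)%:E <= P K.
Proof.
exists regular_measure; split; last exact: regular_ext_ge.
apply/eqP; rewrite eq_le -{1}nuT ext_ltoo/= -nuG.
exact: regular_ext_ge.
Qed.

End RegularOuterMeasure.

(** * Riesz representation *)

Section WithinContinuous.
Variables (R : realType) (X : topologicalType).

Lemma within_continuous_bounded (G : set X) (h : X -> R) :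
  compact G -> {within G, continuous h} ->
  exists2 M, 0 < M & forall x, G x -> `|h x| <= M.
Proof.
move=> cG ch; have /compact_bounded[M [_ hM]] := continuous_compact ch cG.
exists (`|M| + 1) => [|x Gx]; first by rewrite ltr_wpDl.
by apply: (hM (`|M| + 1)); [rewrite ltr_pwDr// ler_norm|exists x].
Qed.

Lemma within_continuousZ (G : set X) (c : R) (h : X -> R) :
  {within G, continuous h} -> {within G, continuous (fun x => c * h x)}.
Proof.
move=> ch x; apply: (@continuousM R (subspace G) (cst c) h); last exact: ch.
exact: cvg_cst.
Qed.

Lemma within_continuousD (G : set X) (g h : X -> R) :
  {within G, continuous g} -> {within G, continuous h} ->
  {within G, continuous (fun x => g x + h x)}.
Proof. by move=> cg ch x; apply: (@continuousD R R^o (subspace G) g h); [exact: cg|exact: ch]. Qed.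

End WithinContinuous.

(** * Borel measurability and integrability of continuous functions *)

Section BorelContinuous.
Variables (R : realType) (X : ptopologicalType).

Lemma open_borel (A : set X) : open A -> measurable (A : set (borel X)).
Proof. exact: sub_sigma_algebra. Qed.

Lemma closed_borel (A : set X) : closed A -> measurable (A : set (borel X)).
Proof.
move=> cA; rewrite -(setCK A); apply: measurableC.
by apply: open_borel; exact: closed_openC.
Qed.

Lemma within_continuous_measurable_fun (G : set X) (h : X -> R) :
  closed G -> {within G, continuous h} -> measurable_fun (G : set (borel X)) h.
Proof.
move=> clG /continuousP ch; have mG := closed_borel clG.
apply: (measurability _ (RGenOpens.measurableE R)).
move=> _ [_ [a [b ->] <-]].
have /open_subspaceP[V oV VG] := ch _ (@interval_open R (BRight a) (BLeft b) isT isT).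
rewrite setIC -VG; apply: measurableI; last exact: mG.
exact: open_borel.
Qed.

Lemma within_continuous_integrable (P : probability (borel X) R) (G : set X)
    (h : X -> R) : hausdorff_space X ->
  compact G -> {within G, continuous h} ->
  P.-integrable (G : set (borel X)) (EFin \o h).
Proof.
move=> hX cG ch; have clG := compact_closed hX cG.
apply: measurable_bounded_integrable; [exact: closed_borel| | |].
- by rewrite (le_lt_trans (probability_le1 _ _)) ?ltry//; exact: closed_borel.
- exact: within_continuous_measurable_fun.
- have [M M0 hM] := within_continuous_bounded cG ch.
  by exists M; split; rewrite ?num_real// => N MN x /= /hM/le_trans; apply; exact: ltW.
Qed.

End BorelContinuous.

(** * Layer-cake estimates for real numbers *)

Section LayerCake.
Variable R : realType.
Implicit Types (r : R) (M : nat).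

(** For [r >= 0] this is the minimum of [M] and the integer part of [r]. *)
Let layers M r : R := \sum_(i < M) (i.+1%:R <= r)%R%:R.

Let layers_full M r : M%:R <= r -> layers M r = M%:R.
Proof.
move=> Mr; rewrite /layers (eq_bigr (fun=> 1)) ?sumr_const ?card_ord// => i _.
by rewrite (le_trans _ Mr)// ler_nat.
Qed.

Lemma layers_le M r : 0 <= r -> \sum_(i < M) (i.+1%:R <= r)%R%:R <= r.
Proof.
move=> r0; rewrite -/(layers M r); elim: M => [|M IH]; first by rewrite /layers big_ord0.
have [Mr|rM] := leP M.+1%:R r; first by rewrite layers_full.
by rewrite /layers big_ord_recr/= [_.+1%:R <= _]leNgt rM addr0.
Qed.

Lemma le_layers M r : r <= M%:R -> r <= 1 + \sum_(i < M) (i.+1%:R <= r)%R%:R.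
Proof.
rewrite -/(layers M r); elim: M => [r0|M IH rM].
  by rewrite /layers big_ord0 addr0 (le_trans r0).
rewrite /layers big_ord_recr/= -/(layers M r).
have [/IH|/ltW Mr] := leP r M%:R.
  by move/le_trans; apply; rewrite addrA lerDl.
by rewrite layers_full// (le_trans rM)// addrA -natr1 [M%:R + 1]addrC lerDl.
Qed.

End LayerCake.

Section Representation.
Variables (R : realType) (X : ptopologicalType) (G : set X).
Hypotheses (hX : hausdorff_space X) (rX : regular_space X) (cG : compact G).

(** Wider than the continuous functions on [G]: it contains all indicators, from which a set
    function can be read off. *)
Definition bounded_fun_on : set (X -> R) :=
  [set h | exists M, forall x, G x -> `|h x| <= M].

Lemma bounded_fun_onD u v :
  bounded_fun_on u -> bounded_fun_on v -> bounded_fun_on (u + v).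
Proof.
move=> [M uM] [N vN]; exists (M + N) => x Gx.
by rewrite (le_trans (ler_normD _ _))// lerD// ?uM ?vN.
Qed.

Lemma bounded_fun_onZ c v : bounded_fun_on v -> bounded_fun_on (c *: v).
Proof.
by move=> [M vM]; exists (`|c| * M) => x Gx; rewrite normrM ler_wpM2l// vM.
Qed.

Lemma bounded_fun_on_cst (c : R) : bounded_fun_on (cst c).
Proof. by exists `|c|. Qed.

Lemma bounded_fun_on_indic A : bounded_fun_on (\1_A).
Proof.
by exists 1 => x _; rewrite indicE ger0_norm ?ler0n// lern1; case: (x \in A).
Qed.

Lemma bounded_fun_on_continuous h : {within G, continuous h} -> bounded_fun_on h.
Proof. by move=> /(within_continuous_bounded cG)[M _ hM]; exists M. Qed.

(** [L_ub] combines positivity and normalization, and makes [L] depend only on values on [G]. *)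
Variable L : (X -> R) -> R.
Hypotheses
  (LD : forall u v, bounded_fun_on u -> bounded_fun_on v -> L (u + v) = L u + L v)
  (LZ : forall c v, bounded_fun_on v -> L (c *: v) = c * L v)
  (L_ub : forall v M, bounded_fun_on v -> (forall x, G x -> v x <= M) -> L v <= M).

Let L_le u v : bounded_fun_on u -> bounded_fun_on v ->
  (forall x, G x -> u x <= v x) -> L u <= L v.
Proof.
move=> bu bv uv; have := @L_ub (u + -1 *: v) 0.
rewrite LD ?LZ//; last exact: bounded_fun_onZ.
rewrite mulN1r subr_le0; apply; first by apply: bounded_fun_onD => //; exact: bounded_fun_onZ.
by move=> x Gx; rewrite /= scaleN1r subr_le0 uv.
Qed.

Let L_cst_on v c : (forall x, G x -> v x = c) -> L v = c.
Proof.
move=> vc; have bv : bounded_fun_on v by exists `|c| => x /vc ->.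
apply/eqP; rewrite eq_le L_ub//=; last by move=> x /vc ->.
rewrite -lerN2 -mulN1r -LZ// L_ub//; first exact: bounded_fun_onZ.
by move=> x Gx; rewrite scaleN1r fctE vc.
Qed.

Let L_sum (N : nat) (F : nat -> X -> R) : (forall i, bounded_fun_on (F i)) ->
  bounded_fun_on (\sum_(i < N) F i) /\ L (\sum_(i < N) F i) = \sum_(i < N) L (F i).
Proof.
move=> bF; elim: N => [|N [IHb IH]].
  rewrite !big_ord0; split; first exact: bounded_fun_on_cst.
  exact: L_cst_on.
rewrite !big_ord_recr/=; split; first exact: bounded_fun_onD.
by rewrite LD// IH.
Qed.

Let nu A : R := L (\1_A).

Let nu_ge0 A : 0 <= nu A.
Proof.
have <- : L 0 = 0 by exact: L_cst_on.
apply: L_le => [||x _]; [exact: bounded_fun_on_cst|exact: bounded_fun_on_indic|].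
by rewrite indicE ler0n.
Qed.

Let nuU A B : A `&` B = set0 -> nu (A `|` B) = nu A + nu B.
Proof.
move=> AB; rewrite /nu -LD; [|exact: bounded_fun_on_indic..].
congr (L _); apply/funext => x; rewrite fctE !indicE in_setU.
have [xA|xA]/= := boolP (x \in A); last by rewrite add0r.
have [xB|xB]/= := boolP (x \in B); last by rewrite addr0.
by have : (A `&` B) x by [split; exact: set_mem]; rewrite AB.
Qed.

(* Layer-cake bound: h <= 1 + sum_i 1_{h >= i} <= 1 + h, and the superlevel sets
   of h in G are compact, where [nu <= P]. *)
Let L_le_integral1 (P : probability (borel X) R) (h : X -> R) :
  (forall K, compact K -> ((nu K)%:E <= P K)%E) ->
  {within G, continuous h} -> (forall x, G x -> 0 <= h x) ->
  L h <= \int[P]_(x in G) h x + 1.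
Proof.
move=> nuP ch h0; have clG := compact_closed hX cG.
have mG : measurable (G : set (borel X)) by exact: closed_borel.
have [r r0 hr] := within_continuous_bounded cG ch.
have [M rM] : exists M : nat, forall x, G x -> h x <= M%:R.
  exists (Num.bound r) => x Gx; rewrite (le_trans (ler_norm _))// (le_trans (hr _ Gx))//.
  exact/ltW/archi_boundP/ltW.
pose A i := G `&` h @^-1` [set y | i.+1%:R <= y].
have clA i : closed (A i).
  have /closed_subspaceP[V clV VG] : closed (h @^-1` [set y | i.+1%:R <= y] : set (subspace G)).
    by move/continuous_closedP : ch; apply; exact: closed_ge.
  by rewrite /A setIC -VG; exact: closedI.
have cA i : compact (A i) by apply: subclosed_compact (clA i) cG _ => x [].
have mA i : measurable (A i : set (borel X)) by exact: closed_borel.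
have AE i x : G x -> \1_(A i) x = (i.+1%:R <= h x)%R%:R :> R.
  move=> Gx; rewrite indicE; congr (nat_of_bool _)%:R.
  by apply/idP/idP => [/set_mem[]//|hx]; exact/mem_set.
have bA i : bounded_fun_on (\1_(A i)) by exact: bounded_fun_on_indic.
have [bS LS] := L_sum M bA.
have bh := bounded_fun_on_continuous ch.
have {bS LS}Lh : L h <= 1 + \sum_(i < M) nu (A i).
  rewrite -[X in X + _](@L_cst_on (cst 1))// -LS -LD//; last exact: bounded_fun_on_cst.
  apply: L_le => // [|x Gx].
    by apply: bounded_fun_onD => //; exact: bounded_fun_on_cst.
  rewrite !fctE (le_trans (le_layers (rM _ Gx)))// lerD2l fct_sumE.
  by rewrite le_eqVlt; apply/orP; left; apply/eqP/eq_bigr => i _; rewrite AE.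
rewrite (le_trans Lh)// addrC lerD2r -lee_fin fineK; last first.
  by apply: integrable_fin_num => //; exact: within_continuous_integrable.
apply: (@le_trans _ _ (\sum_(i < M) P (A i))%E).
  by rewrite -sumEFin lee_sum// => i _; exact: nuP.
have -> : (\sum_(i < M) P (A i) = \int[P]_(x in G) \sum_(i < M) (\1_(A i) x)%:E)%E.
  rewrite ge0_integral_sum//; last first.
    by move=> i; apply/measurable_EFinP; exact: measurable_indic.
  apply: eq_bigr => i _; rewrite integral_indic//; congr (P _).
  by rewrite setIidl// => x [].
apply: ge0_le_integral => //.
- by move=> x _; apply: sume_ge0 => i _; rewrite lee_fin indicE.
- by apply: emeasurable_sum => i; apply/measurable_EFinP; exact: measurable_indic.
- by apply/measurable_EFinP; exact: within_continuous_measurable_fun.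
move=> x Gx; rewrite sumEFin lee_fin (eq_bigr (fun i : 'I_M => (i.+1%:R <= h x)%R%:R)).
  exact/layers_le/h0.
by move=> i _; rewrite AE.
Qed.

Lemma riesz_representation : exists P : probability (borel X) R, P G = 1%E /\
  forall h, {within G, continuous h} -> \int[P]_(x in G) h x = L h.
Proof.
have nuT : nu setT = 1 by apply: L_cst_on => x _; rewrite indicT.
have nuG : nu G = 1 by apply: L_cst_on => x Gx; rewrite indicE mem_set.
have [P [PG nuP]] := regular_probability hX rX nu_ge0 nuU cG nuT nuG.
exists P; split=> //.
have mG : measurable (G : set (borel X)) by exact: closed_borel (compact_closed hX cG).
have ic (h : X -> R) : {within G, continuous h} -> P.-integrable (G : set (borel X)) (EFin \o h).
  exact: within_continuous_integrable.
have cZ (c : R) (h : X -> R) : {within G, continuous h} -> {within G, continuous (c *: h)}.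
  exact: within_continuousZ.
(* The additive error 1 of [L_le_integral1] shrinks to [e] when that bound is applied to [e^-1 *: h]
   and multiplied by [e]. *)
have le0 (h : X -> R) : {within G, continuous h} -> (forall x, G x -> 0 <= h x) ->
    L h <= \int[P]_(x in G) h x.
  move=> ch h0; apply/ler_addgt0Pr => e e0.
  have := @L_le_integral1 P (e^-1 *: h) nuP (cZ _ _ ch).
  rewrite LZ; last exact: bounded_fun_on_continuous.
  rewrite RintegralZl//; last exact: ic.
  rewrite ler_pdivrMl// mulrDr mulrA mulfV ?gt_eqF// mul1r mulr1; apply.
  by move=> x Gx; rewrite mulr_ge0 ?h0// invr_ge0 ltW.
(* Adding a bound [M] of [h] makes it nonnegative and raises both sides by [M], since [P G = 1]. *)
have le (h : X -> R) : {within G, continuous h} -> L h <= \int[P]_(x in G) h x.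
  move=> ch; have [M M0 hM] := within_continuous_bounded cG ch.
  have cM : {within G, continuous (cst M : X -> R)} by move=> x; exact: cvg_cst.
  have := @le0 (h + cst M).
  rewrite LD; [|exact: bounded_fun_on_continuous..].
  rewrite RintegralD//; [|exact: ic..].
  rewrite Rintegral_cst// [fine _](_ : _ = 1) ?mulr1; last by rewrite /= [X in fine X]PG.
  rewrite (@L_cst_on (cst M) M)// lerD2r; apply.
    exact: within_continuousD.
  by move=> x Gx; have := hM _ Gx; rewrite ler_norml fctE => /andP[]; rewrite -lerBlDr sub0r.
(* The same inequality for [- h] gives equality. *)
move=> h ch; apply/eqP; rewrite eq_le le// andbT.
have := le _ (cZ (-1) _ ch).
rewrite LZ; last exact: bounded_fun_on_continuous.
by rewrite RintegralZl ?ic// !mulN1r lerN2.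
Qed.

End Representation.

(** * Duality *)

Section Duality.
Variables (R : realType) (X : ptopologicalType) (G : set X).
Hypotheses (hX : hausdorff_space X) (rX : regular_space X) (cG : compact G).
Hypothesis G0 : G !=set0.

Let mG : measurable (G : set (borel X)).
Proof. exact: closed_borel (compact_closed hX cG). Qed.

(** Weak duality: adding [d] leaves the integral of [k] unchanged, and a probability average
    dominates the infimum. *)
Lemma ereal_inf_le_integral (P : probability (borel X) R) (k d : X -> R) :
  P G = 1%E -> {within G, continuous k} -> {within G, continuous d} ->
  \int[P]_(x in G) d x = 0 ->
  (ereal_inf [set (k x + d x)%:E | x in G] <= (\int[P]_(x in G) k x)%:E)%E.
Proof.
move=> PG ck cd d0; set m := ereal_inf _.
have mle x : G x -> (m <= (k x + d x)%:E)%E.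
  by move=> Gx; apply: ereal_inf_lbound; exists x.
have ik := within_continuous_integrable P hX cG ck.
have id := within_continuous_integrable P hX cG cd.
have ikd := within_continuous_integrable P hX cG (within_continuousD ck cd).
have -> : \int[P]_(x in G) k x = \int[P]_(x in G) (k x + d x).
  by rewrite RintegralD// d0 addr0.
case: m mle => [r| |] mle; last by rewrite leNye.
  have cr : {within G, continuous (cst r : X -> R)} by move=> x; exact: cvg_cst.
  have ir := within_continuous_integrable P hX cG cr.
  rewrite lee_fin; apply: (@le_trans _ _ (\int[P]_(x in G) r)).
    by rewrite Rintegral_cst// [fine _](_ : _ = 1) ?mulr1// /= [X in fine X]PG.
  by apply: le_Rintegral => // x Gx; rewrite -lee_fin; exact: mle.
by have [x /mle] := G0; rewrite leye_eq.
Qed.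

Variables (D : set (X -> R)) (k : X -> R).
Hypotheses (D0 : D 0) (DD : forall c d, D c -> D d -> D (c + d))
  (DZ : forall c d, D d -> D (c *: d)).
Hypothesis Dc : forall d, D d -> {within G, continuous d}.
Hypothesis D_ge0 : forall d, D d -> exists2 x, G x & 0 <= d x.
Hypothesis kc : {within G, continuous k}.

Let B : set (X -> R) := bounded_fun_on G.
Let DB d : D d -> B d. Proof. by move=> /Dc; exact: bounded_fun_on_continuous. Qed.

Let supG (h : X -> R) : R := sup [set h x | x in G].

Let supG_ge h x : B h -> G x -> h x <= supG h.
Proof.
move=> [M hM] Gx; apply: ub_le_sup; last by exists x.
by exists M => _ [y Gy <-]; rewrite (le_trans (ler_norm _))// hM.
Qed.

Let supG_le h M : (forall x, G x -> h x <= M) -> supG h <= M.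
Proof.
move=> hM; apply: ge_sup; first by have [x Gx] := G0; exists (h x), x.
by move=> _ [x Gx <-]; exact: hM.
Qed.

(* Hahn-Banach is applied to p: it vanishes on D, it is dominated by sup_G, and
   [- p (- k)] is the dual value. *)
Let p (h : X -> R) : R := inf [set supG (h + d) | d in D].

(** At a point of [G] where [d] is nonnegative, [h + d] is at least [- M]; thus [D_ge0] keeps [p]
    finite. *)
Let p_has_inf h : B h -> has_inf [set supG (h + d) | d in D].
Proof.
move=> bh; split; first by exists (supG (h + 0)), 0.
have [M hM] := bh; exists (- M) => _ [d Dd <-].
have [x Gx d0] := D_ge0 Dd.
apply: le_trans (supG_ge (bounded_fun_onD bh (DB Dd)) Gx).
have := hM _ Gx; rewrite ler_norml => /andP[+ _]; rewrite fctE; lra.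
Qed.

Let p_le h d : B h -> D d -> p h <= supG (h + d).
Proof. by move=> /p_has_inf[_ lb] Dd; apply: ge_inf => //; exists d. Qed.

Let le_p h m : (forall d, D d -> m <= supG (h + d)) -> m <= p h.
Proof.
move=> hm; apply: lb_le_inf; first by exists (supG (h + 0)), 0.
by move=> _ [d Dd <-]; exact: hm.
Qed.

Let p_sublinear : sublinear_on B p.
Proof.
split=> [u v bu bv|c v c0 bv].
  rewrite -lerBlDr; apply/le_p => d Dd; rewrite lerBlDr -lerBlDl.
  apply/le_p => e De; rewrite lerBlDl.
  apply: (le_trans (p_le (bounded_fun_onD bu bv) (DD Dd De))).
  apply: supG_le => x Gx; rewrite !fctE addrACA lerD//.
    exact: (supG_ge (bounded_fun_onD bu (DB Dd))).
  exact: (supG_ge (bounded_fun_onD bv (DB De))).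
rewrite -ler_pdivrMl//; apply/le_p => d Dd; rewrite ler_pdivrMl//.
apply: (le_trans (p_le (bounded_fun_onZ c bv) (DZ c Dd))).
apply: supG_le => x Gx; rewrite -scalerDr.
change (c * (v x + d x) <= c * supG (v + d)); rewrite ler_pM2l//.
exact: (supG_ge (bounded_fun_onD bv (DB Dd))).
Qed.

Lemma duality : exists P : probability (borel X) R,
  [/\ P G = 1%E, forall d, D d -> \int[P]_(x in G) d x = 0 &
    (\int[P]_(x in G) k x)%:E =
    ereal_sup [set ereal_inf [set (k x + d x)%:E | x in G] | d in D]].
Proof.
have bk : B k by exact: bounded_fun_on_continuous.
have bNk : B (-1 *: k) by exact: bounded_fun_onZ.
have [L [Lp pL LD LZ]] := hahn_banach_tight (@bounded_fun_onD _ _ G)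
  (@bounded_fun_onZ _ _ G) p_sublinear bNk.
(* The choice [d = 0] in [p] gives [L v <= p v <= supG v]. *)
have L_ub v M : B v -> (forall x, G x -> v x <= M) -> L v <= M.
  move=> bv vM; rewrite (le_trans (Lp _ bv))// (le_trans (p_le bv D0))// addr0.
  exact: supG_le.
have [P [PG PL]] := riesz_representation hX rX cG LD LZ L_ub.
(* The choice [- d] in [p] gives [p d <= 0]; as [D] is stable under negation, [L] vanishes on it. *)
have L_le0 d : D d -> L d <= 0.
  move=> Dd; rewrite (le_trans (Lp _ (DB Dd)))//.
  rewrite (le_trans (p_le (DB Dd) (DZ (-1) Dd)))//.
  by apply: supG_le => x Gx; rewrite scaleN1r subrr.
have Pd d : D d -> \int[P]_(x in G) d x = 0.
  move=> Dd; rewrite PL; last exact: Dc.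
  apply/eqP; rewrite eq_le L_le0//=.
  by have := L_le0 _ (DZ (-1) Dd); rewrite LZ ?mulN1r ?oppr_le0//; exact: DB.
exists P; split=> //; apply/eqP; rewrite eq_le; apply/andP; split; last first.
  apply: ub_ereal_sup => _ [d Dd <-].
  by apply: ereal_inf_le_integral => //; [exact: Dc|exact: Pd].
(* For [d] that is [e]-optimal in [p (- k)], [supG (- k + d) < p (- k) + e <= - L k + e]. Hence
   [k - d >= L k - e] on [G], and [- d] is the dual function sought. *)
apply/lee_addgt0Pr => e e0.
have [_ [d Dd <-] dlt] := inf_adherent e0 (p_has_inf bNk).
rewrite -leeBlDr//; apply: (@le_trans _ _ (ereal_inf [set (k x + (-1 *: d) x)%:E | x in G])).
  apply/ereal_infP => _ [x Gx <-]; rewrite -EFinB lee_fin PL//.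
  have := supG_ge (bounded_fun_onD bNk (DB Dd)) Gx.
  move: dlt pL; rewrite -/(p _) LZ// !scaleN1r !fctE; lra.
by apply: ereal_sup_ubound; exists (-1 *: d) => //; exact: DZ.
Qed.

End Duality.

(** * The control problem *)

HB.instance Definition _ (T1 T2 : ptopologicalType) :=
  Pointed.on (T1 * T2)%type.

Lemma hausdorff_prod (X1 X2 : topologicalType) :
  hausdorff_space X1 -> hausdorff_space X2 -> hausdorff_space (X1 * X2)%type.
Proof.
move=> h1 h2 [a b] [c d] cl; congr pair.
  apply: h1 => A B Aa Bc.
  have [] := cl (A `*` setT) (B `*` setT).
  - by exists (A, setT) => //; split=> //; exact: filterT.
  - by exists (B, setT) => //; split=> //; exact: filterT.
  by move=> [x y] [[Ax _] [Bx _]]; exists x.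
apply: h2 => A B Ab Bd.
have [] := cl (setT `*` A) (setT `*` B).
- by exists (setT, A) => //; split=> //; exact: filterT.
- by exists (setT, B) => //; split=> //; exact: filterT.
by move=> [x y] [[_ Ay] [_ By]]; exists y.
Qed.

Lemma within_continuous_cvg_seq (T1 T2 : topologicalType) (A : set T1)
    (h : T1 -> T2) (u : nat -> T1) (x : T1) :
  {within A, continuous h} -> A x -> (forall n, A (u n)) -> u @ \oo --> x ->
  h (u n) @[n --> \oo] --> h x.
Proof.
move=> /subspace_continuousP ch Ax Au ux.
apply: (@cvg_comp _ _ _ u h _ (within A (nbhs x))); last exact: ch.
move=> B /ux[N _ NB]; exists N => // n /NB; apply; exact: Au.
Qed.

(** Reduces continuity to sequences, to which dominated convergence applies. If it failed at [x],
    points of [A] in the balls of radius [1/(n+1)] with values at distance at least [e] would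
    converge to [x]. *)
Lemma seq_within_continuous (R : realType) (T : pseudoMetricType R) (A : set T)
    (h : T -> R) :
  (forall (u : nat -> T) x, A x -> (forall n, A (u n)) -> u @ \oo --> x ->
    h (u n) @[n --> \oo] --> h x) ->
  {within A, continuous h}.
Proof.
move=> hseq; apply/subspace_continuousP => x Ax; apply/cvgrPdist_lt => e e0.
apply: contrapT => nnear.
have uex n : exists y, [/\ A y, ball x n.+1%:R^-1 y & ~ `|h x - h y| < e].
  apply: contrapT => nex; apply: nnear.
  change (nbhs x (fun y => A y -> `|h x - h y| < e)).
  apply: (@filterS _ _ _ (ball x n.+1%:R^-1)); last exact: nbhsx_ballx.
  by move=> y xy Ay; apply: contrapT => hxy; apply: nex; exists y.
have [u uP] := choice uex.
have ux : u @ \oo --> x.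
  apply/cvg_ballP => d d0.
  near=> n; have [_ + _] := uP n; apply: le_ball; apply/ltW.
  by near: n; exact: (near_infty_natSinv_lt (PosNum d0)).
have /cvgrPdist_lt/(_ e e0)[N _ /(_ N (leqnn N))/=] :=
  hseq u x Ax (fun n => let: And3 Au _ _ := uP n in Au) ux.
by have [_ _] := uP N.
Unshelve. all: by end_near. Qed.

Section Model.
Variables (R : realType) (n : nat) (U : pmetricType R) (S : ptopologicalType).
Variable law : probability (borel S) R.
Variables (Y : set 'rV[R]_n) (Uad : 'rV[R]_n -> set U).
Variables (f : 'rV[R]_n -> U -> S -> 'rV[R]_n) (k : 'rV[R]_n -> U -> R).
Hypotheses (Y_nonempty : Y !=set0) (Y_compact : compact Y)
  (U_compact : compact [set: U]).
Hypothesis f_continuous : forall s : S,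
  {within Y `*` [set: U], continuous (fun p : 'rV[R]_n * U => f p.1 p.2 s)}.
Hypothesis f_measurable : forall y u, Y y ->
  measurable_fun [set: borel S] (f y u : borel S -> borel 'rV[R]_n).
Hypotheses (Uad_nonempty : forall y, Y y -> Uad y !=set0)
  (Uad_compact : forall y, Y y -> compact (Uad y))
  (Uad_usc : upper_semicontinuous_on Y Uad).
Hypothesis f_invariant : forall y u s, Y y -> Uad y u -> Y (f y u s).
Hypothesis k_continuous :
  {within Y `*` [set: U], continuous (fun p : 'rV[R]_n * U => k p.1 p.2)}.

Local Notation G := (graph Y Uad).
Local Notation X := ('rV[R]_n * U)%type.

Lemma state_control_hausdorff : hausdorff_space X.
Proof. by apply: hausdorff_prod; [exact: norm_hausdorff|exact: metric_hausdorff]. Qed.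

Let Y_closed : closed Y.
Proof. by apply: compact_closed Y_compact; exact: norm_hausdorff. Qed.

(** The graph is closed in the compact [Y * U]: if [u] is not in [Uad y], disjoint open sets
    separate them, and upper semicontinuity keeps [Uad z] away from [u] for [z] near [y]. *)
Lemma graph_compact : compact G.
Proof.
have cYU : compact (Y `*` [set: U]) by exact: compact_setX.
apply: subclosed_compact cYU _ => [[y u] clG|[y u] []//].
have Yy : Y y.
  apply: Y_closed => A Ay; have [|[z w] [[Yz _] [Az _]]] := clG (A `*` setT).
    by exists (A, setT) => //; split=> //; exact: filterT.
  by exists z.
split=> //=; apply: contrapT => nUu.
have clU : closed (Uad y) by apply: compact_closed (Uad_compact Yy); exact: metric_hausdorff.
have /regular_openP/(_ _ clU nUu)[A [V [oA oV Au UV AV0]]] := @uniform_regular U u.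
have [|[z w] [[Yz zw] [Vz Aw]]] := clG ([set z | Y z -> Uad z `<=` V] `*` A).
  exists ([set z | Y z -> Uad z `<=` V], A) => //; split => /=.
    exact: Uad_usc.
  exact: open_nbhs_nbhs.
suff : (A `&` V) w by rewrite AV0.
by split=> //; exact: Vz.
Qed.

Lemma graph_nonempty : G !=set0.
Proof. by have [y Yy] := Y_nonempty; have [u yu] := Uad_nonempty Yy; exists (y, u). Qed.

Let sub_graph : G `<=` Y `*` [set: U]. Proof. by move=> p []. Qed.

Let phi_measurable (phi : 'rV[R]_n -> R) y u : CY Y phi -> G (y, u) ->
  measurable_fun [set: borel S] (fun s => phi (f y u s)).
Proof.
move=> cphi [/= Yy yu].
apply: (@measurable_comp _ _ _ _ (borel 'rV[R]_n) _ (Y : set (borel 'rV[R]_n)) phi).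
- exact: closed_borel.
- by move=> _ [s _ <-]; exact: f_invariant.
- exact: within_continuous_measurable_fun.
- exact: f_measurable.
Qed.

Let phi_integrable (phi : 'rV[R]_n -> R) y u : CY Y phi -> G (y, u) ->
  law.-integrable [set: borel S] (EFin \o (fun s => phi (f y u s))).
Proof.
move=> cphi Gyu; apply: measurable_bounded_integrable => //.
- by rewrite (le_lt_trans (probability_le1 _ _)) ?ltry.
- exact: phi_measurable.
- have [M M0 phiM] := within_continuous_bounded Y_compact cphi.
  exists M; split; rewrite ?num_real// => N MN s _ /=.
  by rewrite (le_trans (phiM _ _)) ?(ltW MN)//; case: Gyu => ? ?; exact: f_invariant.
Qed.

(** Dominated convergence along sequences in [G]: for fixed [s] the integrands converge by
    continuity of [f] and [phi], and invariance keeps them below the bound of [phi] on [Y]. *)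
Lemma expect_continuous (phi : 'rV[R]_n -> R) : CY Y phi ->
  {within G, continuous (fun p : X => expect law f phi p.1 p.2)}.
Proof.
move=> cphi; apply: seq_within_continuous => u [y v] Gyv Gu ux.
apply: fine_cvg; rewrite fineK; last first.
  by apply: integrable_fin_num => //; exact: phi_integrable.
have [M M0 phiM] := within_continuous_bounded Y_compact cphi.
apply: (@dominated_cvg _ (borel S) _ law setT measurableT
  (fun m s => (phi (f (u m).1 (u m).2 s))%:E) (fun s => (phi (f y v s))%:E) (cst M%:E)).
- move=> m; apply/measurable_EFinP; apply: phi_measurable => //.
  by rewrite -surjective_pairing.
- move=> s _; apply: cvg_EFin; first by near=> m.
  have [Yy yv] := Gyv.
  apply: (within_continuous_cvg_seq cphi); first exact: f_invariant.
    by move=> m; have [] := Gu m; exact: f_invariant.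
  exact: (within_continuous_cvg_seq (@f_continuous s) (sub_graph Gyv)
    (fun m => sub_graph (Gu m)) ux).
- by [].
- by apply: finite_measure_integrable_cst.
- by move=> m s _; rewrite lee_fin phiM//; have [] := Gu m; exact: f_invariant.
Unshelve. all: by end_near. Qed.

(** * The discounted problem, with [eps = 0] allowed *)

Section Discounted.
Variables (y0 : 'rV[R]_n) (eps : R).
Hypotheses (Yy0 : Y y0) (eps_ge0 : 0 <= eps) (eps_le1 : eps <= 1).

Definition disc_drift (psi : 'rV[R]_n -> R) (p : X) : R :=
  (1 - eps) * (expect law f psi p.1 p.2 - psi p.1) + eps * (psi y0 - psi p.1).

Lemma disc_drift_continuous (psi : 'rV[R]_n -> R) :
  CY Y psi -> {within G, continuous (disc_drift psi)}.
Proof.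
move=> cpsi; have cpsi1 : {within G, continuous (fun p : X => psi p.1)}.
  apply: seq_within_continuous => u [y v] [Yy _] Gu ux.
  apply: (within_continuous_cvg_seq cpsi) => //; first by move=> m; case: (Gu m).
  by apply: (cvg_comp _ _ ux); exact: cvg_fst.
have cc : {within G, continuous (cst (eps * psi y0) : X -> R)} by move=> x; exact: cvg_cst.
have -> : disc_drift psi = (fun p => (1 - eps) * expect law f psi p.1 p.2 +
    (-1 * psi p.1 + eps * psi y0)).
  by apply/funext => p; rewrite /disc_drift; ring.
exact: (within_continuousD (within_continuousZ (expect_continuous cpsi))
  (within_continuousD (within_continuousZ cpsi1) cc)).
Qed.

(** Above a minimizer [y] of [psi] on [Y], both [psi (f y u s)] and [psi y0] are at least [psi y],
    because [f y u s] and [y0] lie in [Y]. *)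
Lemma disc_drift_ge0 (psi : 'rV[R]_n -> R) : CY Y psi -> exists2 p, G p & 0 <= disc_drift psi p.
Proof.
move=> cpsi; have [y yY ymin] := compact_EVT_min Y_nonempty Y_compact cpsi.
have Yy := set_mem yY; have [u yu] := Uad_nonempty Yy.
exists (y, u) => //; rewrite addr_ge0// mulr_ge0// subr_ge0 ?ymin ?mem_set//=.
have -> : psi y = \int[law]_s psi y.
  by rewrite Rintegral_cst// [fine _](_ : _ = 1) ?mulr1//= probability_setT.
apply: le_Rintegral => //.
- exact: finite_measure_integrable_cst.
- exact: phi_integrable.
- by move=> s _; rewrite ymin// mem_set//; exact: f_invariant.
Qed.

(** Additivity is claimed on [G], where [f] stays in [Y] and the integrands are therefore
    integrable. *)
Lemma disc_driftD (phi psi : 'rV[R]_n -> R) p : CY Y phi -> CY Y psi -> G p ->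
  disc_drift (fun y => phi y + psi y) p = disc_drift phi p + disc_drift psi p.
Proof.
case: p => y u cphi cpsi Gyu; rewrite /disc_drift /expect RintegralD//; first ring.
all: exact: phi_integrable.
Qed.

Lemma disc_driftZ c (psi : 'rV[R]_n -> R) p : CY Y psi -> G p ->
  disc_drift (fun y => c * psi y) p = c * disc_drift psi p.
Proof.
case: p => y u cpsi Gyu; rewrite /disc_drift /expect RintegralZl//; first ring.
exact: phi_integrable.
Qed.

Lemma duality_disc :
  [/\ attains_min (costs Y Uad k (Wdisc law Y Uad f eps y0)),
      forall psi, CY Y psi ->
        attains_min (dual_values_disc law Y Uad f k eps y0 psi)
    & kstar_disc law Y Uad f k eps y0 = mustar_disc law Y Uad f k eps y0].
Proof.
(* Agreement on [G] only: the drift is linear in [psi] there, so [D] is a linear subspace. *)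
pose D : set (X -> R) :=
  [set d | exists2 psi, CY Y psi & forall p, G p -> d p = disc_drift psi p].
have Ddrift (psi : 'rV[R]_n -> R) : CY Y psi -> D (disc_drift psi) by exists psi.
have kc : {within G, continuous (fun p : X => k p.1 p.2)}.
  exact: continuous_subspaceW k_continuous.
have hX := state_control_hausdorff.
have Dc d : D d -> {within G, continuous d}.
  move=> [psi cpsi dpsi].
  apply: (@subspace_eq_continuous _ _ _ (disc_drift psi)); last exact: disc_drift_continuous.
  by move=> p /set_mem Gp; exact/esym/dpsi.
have [P [PG PD Pk]] : exists P : probability (borel X) R,
  [/\ P G = 1%E, forall d, D d -> \int[P]_(x in G) d x = 0 &
    (\int[P]_(p in G) k p.1 p.2)%:E =
    ereal_sup [set ereal_inf [set (k p.1 p.2 + d p)%:E | p in G] | d in D]].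
  apply: (@duality R X G hX (@uniform_regular _) graph_compact graph_nonempty D
    (fun p => k p.1 p.2)) => //.
  (* Zero is written as a multiple, so that [disc_driftZ] computes its drift. *)
  - exists (fun y => 0 * (cst 0 : 'rV[R]_n -> R) y) => [|p Gp].
      by apply: within_continuousZ => x; exact: cvg_cst.
    rewrite disc_driftZ// ?mul0r// /CY/= => x; exact: cvg_cst.
  - move=> c d [phi cphi cE] [psi cpsi dE]; exists (fun y => phi y + psi y).
      exact: within_continuousD.
    by move=> p Gp; rewrite disc_driftD// -cE// -dE.
  - move=> c d [psi cpsi dE]; exists (fun y => c * psi y).
      exact: within_continuousZ.
    by move=> p Gp; rewrite disc_driftZ// -dE.
  - move=> d [psi cpsi dE]; have [p Gp p0] := disc_drift_ge0 cpsi.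
    by exists p => //; rewrite dE.
have muE : mustar_disc law Y Uad f k eps y0 = (\int[P]_(p in G) k p.1 p.2)%:E.
  rewrite Pk /mustar_disc; congr ereal_sup; apply/seteqP.
  split=> [_ [phi cphi <-]|_ [d [psi cpsi dE] <-]].
    exists (disc_drift phi); first exact: Ddrift.
    congr ereal_inf; apply: eq_imagel => p Gp; congr EFin.
    by rewrite /disc_drift addrA.
  exists psi => //.
  congr ereal_inf; apply: eq_imagel => p Gp; congr EFin.
  by rewrite dE// /disc_drift addrA.
have WP : Wdisc law Y Uad f eps y0 P.
  by split=> // phi cphi; exact: (PD _ (Ddrift _ cphi)).
(* [P] is feasible, which bounds the primal value above; weak duality for every feasible [Q] bounds
   it below. *)
have kE : kstar_disc law Y Uad f k eps y0 = (\int[P]_(p in G) k p.1 p.2)%:E.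
  apply/eqP; rewrite eq_le; apply/andP; split.
    by apply: ereal_inf_lbound; exists P.
  apply/ereal_infP => _ [Q [QG QD] <-]; rewrite Pk.
  apply: ub_ereal_sup => _ [d Dd <-].
  apply: ereal_inf_le_integral => //; [exact: graph_compact|exact: graph_nonempty|exact: Dc|].
  have [psi cpsi dE] := Dd; rewrite -(QD _ cpsi).
  by apply: eq_Rintegral => p /set_mem Gp; rewrite dE.
split; last by rewrite kE muE.
  by rewrite /attains_min -/(kstar_disc _ _ _ _ _ _ _) kE; exists P.
move=> psi cpsi.
have [p Gp pmin] := compact_EVT_min graph_nonempty graph_compact
  (within_continuousD kc (disc_drift_continuous cpsi)).
rewrite /attains_min [ereal_inf _](_ : _ = (k p.1 p.2 + disc_drift psi p)%:E).
  by exists p; [exact: set_mem|rewrite /disc_drift addrA].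
apply/eqP; rewrite eq_le; apply/andP; split.
  by apply: ereal_inf_lbound; exists p; [exact: set_mem|rewrite /disc_drift addrA].
apply/ereal_infP => _ [q Gq <-]; rewrite lee_fin -addrA.
exact: (pmin _ (mem_set Gq)).
Qed.

End Discounted.

(** * The undiscounted problem as the case [eps = 0] *)

Lemma Wdisc0 y0 : Wdisc law Y Uad f 0 y0 = W law Y Uad f.
Proof.
apply/seteqP; split=> P [PG PW]; split=> // phi cphi;
  rewrite -[RHS](PW phi cphi);
  by apply: eq_Rintegral => p _; rewrite subr0 mul1r mul0r addr0.
Qed.

Lemma dual_values_disc0 y0 psi :
  dual_values_disc law Y Uad f k 0 y0 psi = dual_values law Y Uad f k psi.
Proof.
apply: eq_imagel => p _; congr EFin.
by rewrite subr0 mul1r mul0r addr0 addrA.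
Qed.

Lemma duality_undisc :
  [/\ attains_min (costs Y Uad k (W law Y Uad f)),
      forall psi, CY Y psi -> attains_min (dual_values law Y Uad f k psi)
    & kstar law Y Uad f k = mustar law Y Uad f k].
Proof.
(* Any point of [Y] serves as [y0]: its term carries the factor [eps = 0]. *)
have [y0 Yy0] := Y_nonempty.
have [] := duality_disc Yy0 (lexx 0) ler01.
rewrite /kstar_disc /mustar_disc Wdisc0 => Wmin dmin kmu; split=> //.
  by move=> psi /dmin; rewrite dual_values_disc0.
rewrite /kstar kmu; congr ereal_sup.
by apply: eq_imagel => psi _; rewrite dual_values_disc0.
Qed.

End Model.

Theorem proposition3p1 (R : realType) (n : nat)
  (U : pmetricType R) (S : ptopologicalType)
  (law : probability (borel S) R)
  (Y : set 'rV[R]_n) (Uad : 'rV[R]_n -> set U)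
  (f : 'rV[R]_n -> U -> S -> 'rV[R]_n) (k : 'rV[R]_n -> U -> R)
  (Y_nonempty : Y !=set0) (Y_compact : compact Y)
  (U_compact : compact [set: U])
  (S_polish : polish R S)
  (f_bounded : exists M : R, forall y u s, Y y -> `|f y u s| <= M)
  (f_continuous : forall s : S,
     {within Y `*` [set: U], continuous (fun p : 'rV[R]_n * U => f p.1 p.2 s)})
  (f_measurable : forall y u, Y y ->
     measurable_fun [set: borel S] (f y u : borel S -> borel 'rV[R]_n))
  (Uad_nonempty : forall y, Y y -> Uad y !=set0)
  (Uad_compact : forall y, Y y -> compact (Uad y))
  (Uad_usc : upper_semicontinuous_on Y Uad)
  (f_invariant : forall y u s, Y y -> Uad y u -> Y (f y u s))
  (k_continuous :
     {within Y `*` [set: U], continuous (fun p : 'rV[R]_n * U => k p.1 p.2)}) :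
  (forall (y0 : 'rV[R]_n) (eps : R), Y y0 -> 0 < eps -> eps < 1 ->
     [/\ attains_min (costs Y Uad k (Wdisc law Y Uad f eps y0)),
         forall psi, CY Y psi ->
           attains_min (dual_values_disc law Y Uad f k eps y0 psi)
       & kstar_disc law Y Uad f k eps y0 = mustar_disc law Y Uad f k eps y0])
  /\
  [/\ attains_min (costs Y Uad k (W law Y Uad f)),
      forall psi, CY Y psi -> attains_min (dual_values law Y Uad f k psi)
    & kstar law Y Uad f k = mustar law Y Uad f k].
Proof.
split; last exact: duality_undisc.
by move=> y0 eps Yy0 /ltW eps0 /ltW eps1; exact: duality_disc.
Qed.
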